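(* Let $q\ge 2$ be an integer, $\delta\in\left[0,1-\frac1q\right]$, $\gamma\in[0,(q-1)(1-\delta)]$, and let $R$ satisfy $$0\le R<1-(1-\delta+\gamma)H_q\left(\frac{\gamma}{1-\delta+\gamma}\right)-H_q(\delta)+\gamma\log_q(q-1).$$ Then a family of random $q$-ary codes with rate $R$ is list-decodable from $\gamma n$ insertions and $\delta n$ deletions with high probability. That is, there is a polynomial function $L(\cdot)$ such that, if $C_n\subseteq[q]^n$ is the random code whose $\lfloor q^{Rn}\rfloor$ codewords are chosen independently and uniformly at random from $[q]^n$, then the probability that $C_n$ is $(\gamma,\delta,L(n))$-list-decodable tends to $1$ as $n\to\infty$.
   Context: Here $[q]$ is an alphabet of size $q$. A code $C\subseteq[q]^n$ is $(\gamma,\delta,L)$-list-decodable if there is a function $D:[q]^*\to 2^C$ with $|D(w)|\le L$ for every $w\in[q]^*$, such that for every $x\in C$ and every word $w$ obtained from $x$ by at most $\gamma n$ insertions and at most $\delta n$ deletions, $x\in D(w)$. The $q$-ary entropy function is $H_q(x)=x\log_q(q-1)-x\log_q x-(1-x)\log_q(1-x)$ for $x\in[0,1]$, with $0\log_q 0=0$. *)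

(* Defs.v *)
From HB Require Import structures.
From mathcomp Require Import all_boot all_order all_algebra.
From mathcomp Require Import all_classical all_reals all_analysis.

Set Implicit Arguments.
Unset Strict Implicit.
Unset Printing Implicit Defensive.

Import Order.TTheory GRing.Theory Num.Theory.
Import numFieldNormedType.Exports.

Local Open Scope classical_set_scope.
Local Open Scope ring_scope.

Definition logq {R : realType} (q : nat) (x : R) : R := ln x / ln q%:R.

(* No case distinction is needed for 0 * log_q 0 = 0: the product with 0
   vanishes whatever the value of ln at 0. *)
Definition entropy {R : realType} (q : nat) (x : R) : R :=
  x * logq q (q%:R - 1) - x * logq q x - (1 - x) * logq q (1 - x).

(* [indel a b x w]: w is reached from x by a single-symbol insertions and
   b single-symbol deletions, at arbitrary positions and in arbitrary order. *)
Inductive indel (T : Type) : nat -> nat -> seq T -> seq T -> Prop :=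
| indel_refl x : indel 0 0 x x
| indel_ins a b x s t c :
    indel a b x (s ++ t) -> indel a.+1 b x (s ++ c :: t)
| indel_del a b x s t c :
    indel a b x (s ++ c :: t) -> indel a b.+1 x (s ++ t).

Definition list_decodable {R : realType} (q n : nat) (C : {set n.-tuple 'I_q})
    (gamma delta L : R) : Prop :=
  exists D : seq 'I_q -> {set n.-tuple 'I_q},
    (forall w, D w \subset C /\ #|D w|%:R <= L) /\
    (forall (x : n.-tuple 'I_q) (w : seq 'I_q) (a b : nat),
       x \in C -> a%:R <= gamma * n%:R -> b%:R <= delta * n%:R ->
       indel a b x w -> x \in D w).

Definition uniform_prob {R : realType} (T : finType) (E : T -> Prop) : R :=
  #|[set t : T | `[< E t >]]%SET|%:R / #|T|%:R.

(* The floor of q^(rho n), for rho the rate. *)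
Definition num_codewords {R : realType} (q : nat) (rho : R) (n : nat) : nat :=
  Num.truncn (q%:R `^ (rho * n%:R) : R).

(* Independent uniform codewords amount to a uniform choice of the whole
   function from indices to words.  Repetitions may occur, so the code is the
   image of that function. *)
Definition code_of (q n M : nat) (c : {ffun 'I_M -> n.-tuple 'I_q}) :
    {set n.-tuple 'I_q} := [set c i | i : 'I_M]%SET.

Definition prob_list_decodable {R : realType} (q : nat) (rho gamma delta : R)
    (L : nat -> R) (n : nat) : R :=
  uniform_prob (fun c : {ffun 'I_(num_codewords q rho n) -> n.-tuple 'I_q} =>
    list_decodable (code_of c) gamma delta (L n)).

(* Main.v *)
(** Trimming or padding a received word to length exactly
    m = n - floor(delta n) + floor(gamma n) loses no candidate: every codeword
    that may have been sent still has a common subsequence of length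
    k = n - floor(delta n) with the resized word.  So only q^m words matter, and
    neither the number of errors nor the length varies any more.

    The words sharing a subsequence of length k with a given word are counted
    through two weights.  With p = gamma/(1 - delta + gamma), a word of length m
    has at most p^-(m-k) (1-p)^-k subsequences of length k, and each of these has
    at most (delta/(q-1))^-(n-k) (1-delta)^-k supersequences of length n.  The
    logarithm of the product is, up to O(1), n times the entropy expression of
    the theorem, so a random codeword falls in that set with probability
    O(q^-(rho + eps)n) for some eps > 0.  A union bound over the resized words
    and the sets of l indices shows that l codewords fall together in the set of
    some word with probability at most q^m O(q^-eps n)^l.  This tends to 0 for a
    large enough constant l, so a constant polynomial suffices. *)

Require Import Defs.
From mathcomp Require Import all_boot all_order all_algebra.
From mathcomp Require Import all_classical all_reals all_analysis.
From mathcomp Require Import zify ring lra.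

Set Implicit Arguments.
Unset Strict Implicit.
Unset Printing Implicit Defensive.

Import Order.TTheory GRing.Theory Num.Theory.
Import numFieldNormedType.Exports.
Local Open Scope ring_scope.

(** * Subsequences common to a sent and a received word *)

Lemma subseq_catP (T : eqType) (z s t : seq T) :
  subseq z (s ++ t) ->
  exists z1 z2, [/\ z = z1 ++ z2, subseq z1 s & subseq z2 t].
Proof.
case/subseqP=> m; rewrite size_cat => sz_m ->.
exists (mask (take (size s) m) s), (mask (drop (size s) m) t).
split; [|exact: mask_subseq..].
rewrite -{1}(cat_take_drop (size s) m) mask_cat //.
by rewrite size_takel // sz_m leq_addr.
Qed.

(** The witness collects letters of [x] that survive: an insertion leaves it intact, and a deletion
    costs it at most one letter. *)
Lemma indel_common_subseq (T : eqType) a b (x w : seq T) :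
  indel a b x w -> exists z, [/\ subseq z x, subseq z w,
    (size x <= size z + b)%N & (size w <= size z + a)%N].
Proof.
elim=> {a b x w} [x | a b x s t c _ [z [zx zw szx szw]] | a b x s t c _ [z [zx zw szx szw]]].
- by exists x; rewrite !addn0.
- exists z; split=> //; last by move: szw; rewrite !size_cat /=; lia.
  by apply: subseq_trans zw _; apply: cat_subseq (subseq_refl _) (subseq_cons _ _).
- have [z1 [z2 [zE z1s z2t]]] := subseq_catP zw.
  (* The head of [z2] may be matched to the deleted letter; dropping it is safe in either case. *)
  exists (z1 ++ behead z2); split.
  + apply: subseq_trans zx; rewrite zE; apply: cat_subseq (subseq_refl _) _.
    by case: (z2) => //= d y; exact: subseq_cons.
  + apply: cat_subseq z1s _; case: (z2) z2t => [|d y] /=; first by rewrite sub0seq.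
    by case: eqP => // _; apply: subseq_trans; exact: subseq_cons.
  + by move: szx; rewrite zE !size_cat size_behead; lia.
  + move: szw; rewrite zE !size_cat size_behead /=.
    by case: (z2) z2t => [|d y] /=; lia.
Qed.

(** Cutting [w] at [m] removes at most [size w - m <= size z - k] letters of [z], so at least [k]
    are embedded in the part that is kept. The padding [s] is arbitrary. *)
Lemma subseq_resize (T : eqType) (k a m : nat) (z w s : seq T) :
  m = (k + a)%N -> subseq z w -> (k <= size z)%N -> (size w <= size z + a)%N ->
  exists z', [/\ size z' = k, subseq z' z & subseq z' (take m w ++ s)].
Proof.
move=> mE zw kz wz; move: (zw); rewrite -{1}(cat_take_drop m w).
case/subseq_catP=> z1 [z2 [zE z1w z2w]].
have := size_subseq z2w; rewrite size_drop => sz2.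
exists (take k z1); split.
- by apply: size_takel; move: kz wz; rewrite zE size_cat; lia.
- by rewrite zE; apply: subseq_trans (take_subseq _ _) (prefix_subseq _ _).
- by apply: subseq_trans (take_subseq _ _) (subseq_trans z1w (prefix_subseq _ _)).
Qed.

(** * Counting supersequences and subsequences by weights *)

Lemma leq_card_bigcup (I T : finType) (P : pred I) (A : I -> {set T}) :
  (#|\bigcup_(i | P i) A i| <= \sum_(i | P i) #|A i|)%N.
Proof.
elim/big_rec2: _ => [|i n B _ le_Bn]; first by rewrite cards0.
by apply: leq_trans (leq_card_setU _ _) _; rewrite leq_add2l.
Qed.

(* Draw n letters, matching z greedily: the next letter of z has probability u
   and every other letter v; once z is exhausted, draw uniformly (1/#|T| >= v).
   Every supersequence of z then has probability at least
   v ^ (n - size z) * u ^ (size z). *)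
Lemma supseq_weight (R : realFieldType) (T : finType) (u v : R) (n : nat) (z : seq T) :
  0 <= v -> v <= u -> u + #|T|.-1%:R * v = 1 -> (size z <= n)%N ->
  #|[set x : n.-tuple T | subseq z x]|%:R * (v ^+ (n - size z) * u ^+ size z) <= 1.
Proof.
move=> v0 vu uv1; have u0 := le_trans v0 vu.
elim: n z => [|n IHn] [|d z] szn //.
- rewrite !mulr1 lern1; apply: leq_trans (max_card _) _.
  by rewrite card_tuple.
- rewrite subn0 expr0 mulr1.
  apply: (@le_trans _ _ ((#|T|%:R * v) ^+ n.+1)).
    rewrite exprMn; apply: ler_wpM2r; first exact: exprn_ge0.
    by rewrite -natrX ler_nat -card_tuple max_card.
  rewrite exprn_ile1 ?mulr_ge0 // -[leRHS]uv1.
  apply: (@le_trans _ _ (#|T|.-1.+1%:R * v)).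
    by rewrite ler_wpM2r // ler_nat leqSpred.
  by rewrite -natr1 mulrDl mul1r addrC lerD2r.
- set A := [set x : n.-tuple T | subseq z x].
  set B := [set x : n.-tuple T | subseq (d :: z) x].
  have cardle : (#|[set x : n.+1.-tuple T | subseq (d :: z) x]| <= #|A| + #|T|.-1 * #|B|)%N.
    set f := fun p : T * n.-tuple T => [tuple of p.1 :: p.2].
    apply: (@leq_trans #|[set [tuple of d :: x] | x : n.-tuple T in A] :|: f @: finset.setX [set~ d] B|).
      apply/subset_leq_card/fintype.subsetP => x.
      case/tupleP: x => c x; rewrite !inE /=.
      case: eqP => [->|/eqP dc] sub; apply/orP; [left|right].
        by apply: imset_f; rewrite inE.
      by apply/imsetP; exists (c, x); rewrite // !inE /= sub andbT eq_sym.
    apply: leq_trans (leq_card_setU _ _) _; apply: leq_add; first exact: leq_imset_card.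
    by apply: leq_trans (leq_imset_card _ _) _; rewrite finset.cardsX cardsC1.
  rewrite /= subSS exprS.
  have IHA := IHn z szn.
  apply: (@le_trans _ _ ((#|A| + #|T|.-1 * #|B|)%:R * (v ^+ (n - size z) * (u * u ^+ size z)))).
    by rewrite ler_wpM2r ?ler_nat ?mulr_ge0 ?exprn_ge0.
  rewrite natrD mulrDl -[leRHS]uv1; apply: lerD.
    by rewrite -/A in IHA; rewrite (_ : _ * _ = u * (#|A|%:R * (v ^+ (n - size z) * u ^+ size z))) ?ler_piMr //; ring.
  (* When [size z = n], no word of length [n] contains [d :: z]. Otherwise [n - size z] is a
     successor and supplies the factor [v]. *)
  have [zn|zn] := ltnP (size z) n; last first.
    suff -> : #|B| = 0%N by rewrite muln0 mul0r mulr_ge0.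
    apply: eq_card0 => x; rewrite inE; apply/negP => /size_subseq.
    by rewrite size_tuple /= leqNgt ltnS zn.
  have := IHn (d :: z) zn; rewrite -/B /= => IHB.
  rewrite natrM (_ : (n - size z)%N = (n - (size z).+1).+1); last by lia.
  rewrite (_ : _ * _ * _ = (#|T|.-1%:R * v) * (#|B|%:R * (v ^+ (n - (size z).+1) * u ^+ (size z).+1))); last by rewrite !exprS; ring.
  by rewrite ler_piMr ?mulr_ge0.
Qed.

(** Keep each position of [w] independently with probability [r]. Distinct [z] come from distinct
    sets of [k] kept positions, each of probability [p ^+ (size w - k) * r ^+ k]. The induction is a
    Pascal recursion on whether the first letter is kept. *)
Lemma subseq_weight (R : realFieldType) (T : finType) (p r : R) (k : nat) (w : seq T) :
  0 <= p -> 0 <= r -> p + r = 1 -> (k <= size w)%N ->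
  #|[set z : k.-tuple T | subseq z w]|%:R * (p ^+ (size w - k) * r ^+ k) <= 1.
Proof.
move=> p0 r0 pr1.
have p1 : p <= 1 by lra.
elim: w k => [|c w IHw] [|k] szk //.
- rewrite !mulr1 lern1; apply: leq_trans (max_card _) _; by rewrite card_tuple.
- rewrite subn0 expr0 mulr1 mulr_ile1 ?exprn_ge0 ?exprn_ile1 //.
  by rewrite lern1; apply: leq_trans (max_card _) _; rewrite card_tuple.
- set A := [set z : k.-tuple T | subseq z w].
  set B := [set z : k.+1.-tuple T | subseq z w].
  have cardle : (#|[set z : k.+1.-tuple T | subseq z (c :: w)]| <= #|A| + #|B|)%N.
    apply: (@leq_trans #|[set [tuple of c :: x] | x : k.-tuple T in A] :|: B|).
      apply/subset_leq_card/fintype.subsetP => x.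
      case/tupleP: x => d x; rewrite !inE /=.
      case: eqP => [->|_] sub; apply/orP; [left|by right].
      by apply: imset_f; rewrite inE.
    by apply: leq_trans (leq_card_setU _ _) _; rewrite leq_add2r leq_imset_card.
  have IHA := IHw k szk.
  rewrite /= subSS exprS.
  apply: (@le_trans _ _ ((#|A| + #|B|)%:R * (p ^+ (size w - k) * (r * r ^+ k)))).
    by rewrite ler_wpM2r ?ler_nat ?mulr_ge0 ?exprn_ge0.
  rewrite natrD mulrDl -[leRHS]pr1 [leRHS]addrC; apply: lerD.
    by rewrite -/A in IHA; rewrite (_ : _ * _ = r * (#|A|%:R * (p ^+ (size w - k) * r ^+ k))) ?ler_piMr //; ring.
  have [zn|zn] := ltnP k (size w); last first.
    suff -> : #|B| = 0%N by rewrite mul0r.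
    apply: eq_card0 => x; rewrite inE; apply/negP => /size_subseq.
    by rewrite size_tuple leqNgt ltnS zn.
  have := IHw k.+1 zn; rewrite -/B => IHB.
  rewrite (_ : (size w - k)%N = (size w - k.+1).+1); last by lia.
  rewrite (_ : _ * _ = p * (#|B|%:R * (p ^+ (size w - k.+1) * r ^+ k.+1))); last by rewrite !exprS; ring.
  by rewrite ler_piMr.
Qed.

Definition near_words (T : finType) (n k : nat) (w : seq T) : {set n.-tuple T} :=
  [set x : n.-tuple T | [exists z : k.-tuple T, subseq z w && subseq z x]].

(** Cover the set by the supersequences of each [z] below [w]: the second weight bounds every term
    by 1, and the first bounds the number of terms. *)
Lemma near_words_weight (R : realFieldType) (T : finType) (p r u v : R) (n k : nat) (w : seq T) :
  0 <= p -> 0 <= r -> p + r = 1 ->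
  0 <= v -> v <= u -> u + #|T|.-1%:R * v = 1 ->
  (k <= n)%N -> (k <= size w)%N ->
  #|near_words n k w|%:R * (p ^+ (size w - k) * r ^+ k * (v ^+ (n - k) * u ^+ k)) <= 1.
Proof.
move=> p0 r0 pr1 v0 vu uv1 kn kw; have u0 := le_trans v0 vu.
set P := p ^+ _ * _; set V := v ^+ _ * _.
have P0 : 0 <= P by rewrite mulr_ge0 ?exprn_ge0.
have V0 : 0 <= V by rewrite mulr_ge0 ?exprn_ge0.
set Z := [set z : k.-tuple T | subseq z w].
have le_card : (#|near_words n k w| <= \sum_(z in Z) #|[set x : n.-tuple T | subseq z x]|)%N.
  apply: leq_trans (leq_card_bigcup _ _).
  apply/subset_leq_card/fintype.subsetP => x; rewrite inE => /existsP[z /andP[zw zx]].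
  by apply/finset.bigcupP; exists z; rewrite inE.
apply: le_trans (subseq_weight p0 r0 pr1 kw); rewrite -/P -/Z.
rewrite mulrCA mulrC ler_wpM2r //.
apply: (@le_trans _ _ ((\sum_(z in Z) #|[set x : n.-tuple T | subseq z x]|)%:R * V)).
  by rewrite ler_wpM2r // ler_nat.
rewrite natr_sum mulr_suml -sum1_card natr_sum; apply: ler_sum => z _.
have := @supseq_weight R T u v n z v0 vu uv1; rewrite size_tuple; exact.
Qed.

(** * Random codes and the list decoder *)

(** Union bound over the sets [J] of [l] indices: a random function maps [J] into [S] with
    probability [(#|S| / #|T|) ^ l]. Denominators are cleared to stay in the naturals. *)
Lemma card_ffun_hit (I T : finType) (S : {set T}) (l : nat) :
  (#|[set c : {ffun I -> T} | l <= #|[set c i | i : I] :&: S|]| * #|T| ^ l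
    <= 'C(#|I|, l) * #|S| ^ l * #|T| ^ #|I|)%N.
Proof.
set D := [set J : {set I} | #|J| == l].
set F := fun J : {set I} => [set c : {ffun I -> T} | [forall i in J, c i \in S]].
have le_card : (#|[set c : {ffun I -> T} | l <= #|[set c i | i : I] :&: S|]|
    <= \sum_(J in D) #|F J|)%N.
  apply: leq_trans (leq_card_bigcup _ _).
  apply/subset_leq_card/fintype.subsetP => c; rewrite inE => hit.
  (* Distinct values have distinct indices, so repeated codewords do no harm. *)
  have : (l <= #|[set i | c i \in S]|)%N.
    apply: leq_trans hit _; apply: leq_trans (leq_imset_card c _).
    apply/subset_leq_card/fintype.subsetP => y; rewrite inE => /andP[/imsetP[i _ ->] yS].
    by rewrite imset_f // inE.
  case/card_geqP=> s [s_uniq sz_s sS].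
  apply/finset.bigcupP; exists [set i in s].
    by rewrite inE cardsE -sz_s; apply/eqP/card_uniqP.
  by rewrite inE; apply/forall_inP => i; rewrite inE => /sS; rewrite inE.
have card_F J : J \in D -> (#|F J| * #|T| ^ l = #|S| ^ l * #|T| ^ #|I|)%N.
  rewrite inE => /eqP cardJ.
  have -> : #|F J| = (#|S| ^ l * #|T| ^ (#|I| - l))%N.
    rewrite -cardJ (_ : (#|I| - #|J|)%N = #|~: J|); last by rewrite [RHS]cardsCs finset.setCK.
    rewrite (_ : #|F J| = #|family (fun i => if i \in J then mem S else mem T)|).
      rewrite card_family foldrE big_map big_enum /= (bigID (mem J)) /=.
      congr (_ * _)%N.
        rewrite (eq_bigr (fun=> #|S|)) ?prod_nat_const // => i iJ.
        by rewrite iJ.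
      rewrite (eq_bigr (fun=> #|T|)) => [|i /negbTE iJ]; last by rewrite iJ.
      rewrite prod_nat_const; congr (_ ^ _)%N; apply: eq_card => i.
      by rewrite !inE.
    apply: eq_card => c; rewrite inE; apply/forall_inP/familyP => h i.
      by case: ifP => // /h.
    by move=> iJ; have := h i; rewrite iJ.
  by rewrite -mulnA -expnD subnK // -cardJ max_card.
apply: leq_trans (leq_mul le_card (leqnn _)) _.
rewrite big_distrl /= (eq_bigr _ card_F) sum_nat_const card_draws mulnA.
exact: leqnn.
Qed.

Lemma bin_leq_exp m n : ('C(n, m) <= n ^ m)%N.
Proof.
apply: leq_trans (_ : n ^_ m <= _)%N; first by rewrite -bin_ffact leq_pmulr ?fact_gt0.
elim: m => // m IHm; rewrite ffactnSr expnSr; apply: leq_mul IHm _; exact: leq_subr.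
Qed.

Lemma list_decodable_near_words (R : realType) (q n k m a b l : nat)
    (C : {set n.-tuple 'I_q}) (gamma delta : R) :
  (0 < q)%N -> n = (k + b)%N -> m = (k + a)%N ->
  (forall j : nat, j%:R <= gamma * n%:R -> (j <= a)%N) ->
  (forall j : nat, j%:R <= delta * n%:R -> (j <= b)%N) ->
  (forall w : m.-tuple 'I_q, #|C :&: near_words n k w| <= l)%N ->
  list_decodable C gamma delta l%:R.
Proof.
move=> q_gt0 nE mE le_a le_b sparse.
(* The decoder resizes the word, padding with the letter 0, and lists the codewords near the
   result. *)
pose pad w : seq 'I_q := take m w ++ nseq (m - size (take m w)) (Ordinal q_gt0).
have sz_pad w : size (pad w) == m.
  by rewrite size_cat size_nseq subnKC // size_take_min geq_minl.
exists (fun w => C :&: near_words n k (pad w)); split=> [w|x w i j xC /le_a ia /le_b jb].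
  by rewrite subsetIl ler_nat (sparse (Tuple (sz_pad w))).
case/indel_common_subseq=> z [zx zw]; rewrite size_tuple => sz_x sz_w.
have [z' [/eqP sz' z'z z'w]] : exists z' : seq 'I_q,
    [/\ size z' = k, subseq z' z & subseq z' (pad w)].
  by apply: (@subseq_resize _ k a m z w) => //; lia.
rewrite !inE xC; apply/existsP; exists (Tuple sz').
by rewrite /= z'w (subseq_trans z'z).
Qed.

Lemma prob_list_decodable_ge (R : realType) (q n k m a b l M : nat)
    (gamma delta B : R) :
  (0 < q)%N -> n = (k + b)%N -> m = (k + a)%N ->
  (forall j : nat, j%:R <= gamma * n%:R -> (j <= a)%N) ->
  (forall j : nat, j%:R <= delta * n%:R -> (j <= b)%N) ->
  (forall w : m.-tuple 'I_q, #|near_words n k w|%:R <= B) ->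
  1 - q%:R ^+ m * (M%:R * B / q%:R ^+ n) ^+ l <=
  Defs.uniform_prob (fun c : {ffun 'I_M -> n.-tuple 'I_q} =>
    list_decodable (code_of c) gamma delta l%:R) :> R.
Proof.
move=> q_gt0 nE mE le_a le_b leB; rewrite /Defs.uniform_prob.
set G := [set _ | _]%SET.
pose H (w : m.-tuple 'I_q) :=
  [set c : {ffun 'I_M -> n.-tuple 'I_q} | (l <= #|code_of c :&: near_words n k w|)%N]%SET.
have T_gt0 : 0 < #|{ffun 'I_M -> n.-tuple 'I_q}|%:R :> R.
  by rewrite ltr0n card_ffun card_tuple !card_ord !expn_gt0 q_gt0.
have leH w : #|H w|%:R <= (M%:R * B / q%:R ^+ n) ^+ l * #|{ffun 'I_M -> n.-tuple 'I_q}|%:R.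
  have N_gt0 : 0 < (q%:R ^+ n) ^+ l :> R by rewrite !exprn_gt0 ?ltr0n.
  rewrite expr_div_n mulrAC ler_pdivlMr //.
  have := card_ffun_hit 'I_M (near_words n k w) l.
  rewrite card_ffun card_tuple !card_ord -(ler_nat R) => hit.
  apply: le_trans (_ : #|H w|%:R * (q%:R ^+ n) ^+ l <= ('C(M, l) * #|near_words n k w| ^ l * (q ^ n) ^ M)%:R) _.
    by move: hit; rewrite -/(H w) natrM !natrX.
  rewrite natrM ler_wpM2r // natrM exprMn ler_pM //.
    by rewrite -natrX ler_nat bin_leq_exp.
  by rewrite natrX lerXn2r ?nnegrE ?(le_trans _ (leB w)).
have leC : (#|~: G| <= \sum_(w : m.-tuple 'I_q) #|H w|)%N.
  apply: leq_trans (leq_card_bigcup _ _).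
  apply/subset_leq_card/fintype.subsetP => c; rewrite !inE; apply: contraNT => hc.
  apply/asboolP; apply: (list_decodable_near_words q_gt0 nE mE le_a le_b) => w.
  (* Failure means more than [l] codewords near [w]; the events [H w] ask only for [l]. *)
  rewrite leqNgt; apply: contra hc => lw; apply/finset.bigcupP; exists w => //.
  by rewrite inE ltnW.
rewrite ler_pdivlMr // mulrBl mul1r lerBlDr -[in leLHS](cardsC G) natrD lerD2l.
apply: (@le_trans _ _ (\sum_(w : m.-tuple 'I_q) #|H w|)%:R); first by rewrite ler_nat.
rewrite natr_sum; apply: le_trans (ler_sum _ (fun w _ => leH w)) _.
by rewrite sumr_const card_tuple card_ord -[leLHS]mulr_natl natrX mulrA.
Qed.

(** * From integer exponents to entropy *)

(** Since [ln x <= 0], a larger exponent gives a smaller power. At [x = 0] the last hypothesis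
    forces [a = 0], and both sides are 1. *)
Lemma expR_mul_ln_le (R : realType) (x s : R) (a : nat) :
  0 <= x <= 1 -> a%:R <= s -> (x = 0 -> s = 0) -> expR (s * ln x) <= x ^+ a.
Proof.
move=> /andP[]; rewrite le_eqVlt => /predU1P[<- _ as_ /(_ erefl) s0|x_gt0 x1 as_ _].
  by move: as_; rewrite s0 mul0r expR0 lern0 => /eqP ->.
by rewrite -{2}(lnK x_gt0) -expRM_natl ler_expR ler_wnM2r // ln_le0.
Qed.

(** The leading factor [r] pays for rounding: [k = n - b] may exceed [(1 - delta) * n], but by less
    than 1. *)
Lemma weight_ge (R : realType) (gamma delta p r u v : R) (n a b k : nat) :
  0 <= p <= 1 -> 0 < r <= 1 -> 0 < u -> 0 <= v <= u ->
  (p = 0 -> gamma = 0) -> (v = 0 -> delta = 0) ->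
  a%:R <= gamma * n%:R -> b%:R <= delta * n%:R -> delta * n%:R < b.+1%:R ->
  n = (k + b)%N ->
  r * expR (n%:R * (gamma * ln p + (1 - delta) * ln r + delta * ln v + (1 - delta) * ln u))
    <= p ^+ a * r ^+ k * (v ^+ b * u ^+ k).
Proof.
move=> p01 /andP[r0 r1] u0 /andP[v0 vu] p_g v_d la lb lb' nE.
have r01 : 0 <= r <= 1 by rewrite ltW.
have vu01 : 0 <= v / u <= 1 by rewrite divr_ge0 ?ler_pdivrMr ?mul1r // ltW.
have hp := expR_mul_ln_le p01 la (fun h => etrans (congr1 (fun x => x * n%:R) (p_g h)) (mul0r _)).
have nkb : n%:R = k%:R + b%:R :> R by rewrite nE natrD.
have hr : expR (((1 - delta) * n%:R + 1) * ln r) <= r ^+ k.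
  apply: expR_mul_ln_le => //; last by move=> r_0; rewrite r_0 ltxx in r0.
  by move: lb'; rewrite -natr1 nkb; lra.
have hv : expR (delta * n%:R * ln (v / u)) <= (v / u) ^+ b.
  apply: expR_mul_ln_le => // /eqP; rewrite mulf_eq0 invr_eq0 (gt_eqF u0) orbF => /eqP.
  by move/v_d ->; rewrite mul0r.
(* In this form only [b] is rounded, and rounding down helps because [v / u <= 1]; no second factor
   is lost. *)
have vuE : v ^+ b * u ^+ k = (v / u) ^+ b * u ^+ n.
  by rewrite expr_div_n nE exprD (mulrC (u ^+ k)) mulrA divfK // expf_neq0 // gt_eqF.
have hu : u ^+ n = expR (n%:R * ln u) by rewrite expRM_natl lnK.
have dln : delta * ln (v / u) = delta * ln v - delta * ln u.
  move: v0; rewrite le_eqVlt => /predU1P[v_0|v0]; first by rewrite v_d // !mul0r subr0.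
  by rewrite ln_div ?posrE // mulrBr.
rewrite vuE hu -{1}(lnK r0) -expRD.
apply: le_trans (_ : expR (gamma * n%:R * ln p) * expR (((1 - delta) * n%:R + 1) * ln r) *
   (expR (delta * n%:R * ln (v / u)) * expR (n%:R * ln u)) <= _); last first.
  by rewrite !ler_pM ?mulr_ge0 ?expR_ge0.
have nd : delta * n%:R * ln (v / u) = n%:R * (delta * ln v - delta * ln u).
  by rewrite -dln; ring.
by rewrite -!expRD ler_expR nd; lra.
Qed.

Lemma entropy_weight (R : realType) (q : nat) (gamma delta : R) :
  (1 < q)%N -> 0 <= delta -> 0 < 1 - delta + gamma ->
  let p := gamma / (1 - delta + gamma) in
  ln q%:R * ((1 - delta + gamma) * entropy q p + entropy q delta
             - gamma * logq q (q%:R - 1)) =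
  - (gamma * ln p + (1 - delta) * ln (1 - p)
     + delta * ln (delta / (q%:R - 1)) + (1 - delta) * ln (1 - delta)).
Proof.
move=> q1 d0 s0 p.
have lnq : ln q%:R != 0 :> R by rewrite gt_eqF // ln_gt0 // ltr1n.
have q10 : 0 < q%:R - 1 :> R by rewrite subr_gt0 ltr1n.
have dE : delta * ln (delta / (q%:R - 1)) = delta * ln delta - delta * ln (q%:R - 1).
  move: d0; rewrite le_eqVlt => /predU1P[<-|d0]; first by rewrite !mul0r subr0.
  by rewrite ln_div ?posrE // mulrBr.
have sp : (1 - delta + gamma) * p = gamma by rewrite mulrC divfK // gt_eqF.
have s1p : (1 - delta + gamma) * (1 - p) = 1 - delta by rewrite mulrBr mulr1 sp; ring.
(* Forgetting the value of [p] makes it an atom for [field]; [sp] and [s1p] keep what is needed. *)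
rewrite dE /entropy /logq; move: p sp s1p => p sp s1p.
transitivity ((1 - delta + gamma) * p * (ln (q%:R - 1) - ln p)
  - (1 - delta + gamma) * (1 - p) * ln (1 - p) + (delta * ln (q%:R - 1)
  - delta * ln delta - (1 - delta) * ln (1 - delta)) - gamma * ln (q%:R - 1)).
  by field.
by rewrite sp s1p; ring.
Qed.

(** * The exponential bound and the limit *)

Lemma prob_list_decodable_exp (R : realType) (q : nat) (delta gamma rho : R) :
  (2 <= q)%N -> 0 <= delta <= 1 - q%:R^-1 -> 0 <= gamma ->
  rho < 1 - (1 - delta + gamma) * entropy q (gamma / (1 - delta + gamma))
          - entropy q delta + gamma * logq q (q%:R - 1) ->
  exists (l : nat) (K : R), forall n,
    1 - K * expR (-1) ^+ n <= prob_list_decodable q rho gamma delta (fun=> l%:R) n.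
Proof.
move=> hq /andP[d0 d1] g0 hrho.
have q0 : 0 < q%:R :> R by rewrite ltr0n; lia.
have q10 : 0 < q%:R - 1 :> R by rewrite subr_gt0 ltr1n.
set u := 1 - delta; set s := u + gamma; set p := gamma / s; set v := delta / (q%:R - 1).
have u0 : 0 < u by apply: lt_le_trans (_ : q%:R^-1 <= _); rewrite ?invr_gt0 // /u; lra.
have s0 : 0 < s by rewrite /s; lra.
have p0 : 0 <= p by rewrite divr_ge0 // ltW.
have p1 : 0 < 1 - p by rewrite subr_gt0 ltr_pdivrMr // mul1r /s; lra.
have v0 : 0 <= v by rewrite divr_ge0 // ltW.
(* This is the condition [delta <= 1 - q%:R^-1]. *)
have vu : v <= u.
  rewrite ler_pdivrMr // /u -subr_ge0.
  have -> : (1 - delta) * (q%:R - 1) - delta = q%:R * (1 - q%:R^-1 - delta).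
    by field; rewrite gt_eqF.
  by rewrite mulr_ge0 ?subr_ge0 // ltW.
have cardq : #|'I_q|.-1%:R = q%:R - 1 :> R by rewrite card_ord -subn1 natrB //; lia.
have uv1 : u + #|'I_q|.-1%:R * v = 1.
  by rewrite cardq /u /v; field; rewrite gt_eqF.
have /= W := entropy_weight hq d0 s0; rewrite -/u -/s -/p -/v in W.
set w := gamma * ln p + _ + _ + _ in W.
set X := _ - gamma * _ in W.
have lnq : 0 < ln q%:R :> R by rewrite ln_gt0 // ltr1n.
(* The gap between [rho] and its threshold [1 - X], in natural logarithms. *)
pose eta := ln q%:R * (1 - X - rho).
have eta0 : 0 < eta by rewrite mulr_gt0 // subr_gt0 /X; move: hrho; rewrite -/u -/s -/p; lra.
(* Large enough for [expR (- (n%:R * eta)) ^+ l] to absorb the at most [q ^ ((1 + gamma) n)] resized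
   words and leave [expR (-1) ^+ n]. *)
pose l := (Num.truncn (((1 + gamma) * ln q%:R + 1) / eta)).+1.
have leta : (1 + gamma) * ln q%:R + 1 <= l%:R * eta.
  rewrite -ler_pdivrMr // ltW //.
  by have /andP[] : _ := @truncn_itv R (((1 + gamma) * ln q%:R + 1) / eta)
    (divr_ge0 (addr_ge0 (mulr_ge0 (addr_ge0 ler01 g0) (ltW lnq)) ler01) (ltW eta0)).
(* The constant gathers the rounding factor [1 - p], once for each of the [l] codewords. *)
exists l, (((1 - p)^-1) ^+ l) => n.
have gn0 : 0 <= gamma * n%:R by rewrite mulr_ge0.
have dn0 : 0 <= delta * n%:R by rewrite mulr_ge0.
pose a := Num.truncn (gamma * n%:R); pose b := Num.truncn (delta * n%:R).
have /andP[la _] : a%:R <= gamma * n%:R < a.+1%:R := truncn_itv gn0.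
have /andP[lb lb'] : b%:R <= delta * n%:R < b.+1%:R := truncn_itv dn0.
have bn : (b <= n)%N.
  rewrite -(ler_nat R); apply: le_trans lb _; apply: ler_piMl => //.
  by move: u0; rewrite /u; lra.
have nE : n = ((n - b) + b)%N by rewrite subnK.
set k := (n - b)%N in nE.
have le_a (j : nat) : j%:R <= gamma * n%:R -> (j <= a)%N by rewrite truncn_ge_nat.
have le_b (j : nat) : j%:R <= delta * n%:R -> (j <= b)%N by rewrite truncn_ge_nat.
clearbody k a b.
have leB (y : (k + a).-tuple 'I_q) :
    #|near_words n k y|%:R <= (1 - p)^-1 * expR (- (n%:R * w)).
  have kn : (k <= n)%N by rewrite nE leq_addr.
  have ky : (k <= size y)%N by rewrite size_tuple leq_addr.
  have := near_words_weight p0 (ltW p1) (subrKC p 1) v0 vu uv1 kn ky.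
  rewrite size_tuple addKn (_ : (n - k)%N = b); last by rewrite nE addKn.
  rewrite expRN -invfM -div1r ler_pdivlMr ?mulr_gt0 ?expR_gt0 // => le1.
  apply: le_trans le1; rewrite ler_wpM2l //.
  apply: weight_ge => //; rewrite ?p0 ?p1 ?v0 //=; try lra.
    by move/eqP; rewrite mulf_eq0 invr_eq0 (gt_eqF s0) orbF => /eqP.
  by move/eqP; rewrite mulf_eq0 invr_eq0 (gt_eqF q10) orbF => /eqP.
have := prob_list_decodable_ge l (num_codewords q rho n) (ltnW hq) nE erefl le_a le_b leB.
apply: le_trans; rewrite lerD2l lerN2.
set M := num_codewords q rho n.
have leM : M%:R <= expR (rho * n%:R * ln q%:R).
  rewrite (_ : expR _ = q%:R `^ (rho * n%:R)); last by rewrite /powR gt_eqF.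
  by have /andP[] := truncn_itv (powR_ge0 (q%:R : R) (rho * n%:R)).
have qE j : q%:R ^+ j = expR (j%:R * ln q%:R) :> R by rewrite expRM_natl lnK.
have leMB : M%:R * ((1 - p)^-1 * expR (- (n%:R * w))) / q%:R ^+ n
    <= (1 - p)^-1 * expR (- (n%:R * eta)).
  rewrite qE -expRN mulrCA -mulrA ler_wpM2l ?invr_ge0 ?(ltW p1) //.
  apply: le_trans (_ : expR (rho * n%:R * ln q%:R) * expR (- (n%:R * w)) * expR (- (n%:R * ln q%:R)) <= _).
    by rewrite !ler_wpM2r ?expR_ge0.
  rewrite -!expRD ler_expR /eta.
  have -> : n%:R * (ln q%:R * (1 - X - rho)) = n%:R * (ln q%:R - ln q%:R * X - ln q%:R * rho).
    by ring.
  by rewrite W; lra.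
apply: (@le_trans _ _ (q%:R ^+ (k + a) * ((1 - p)^-1 * expR (- (n%:R * eta))) ^+ l)).
  rewrite ler_wpM2l ?exprn_ge0 ?(ltW q0) // lerXn2r ?nnegrE //.
    by rewrite !mulr_ge0 ?invr_ge0 ?exprn_ge0 ?expR_ge0 ?(ltW q0) ?(ltW p1).
  by rewrite !mulr_ge0 ?invr_ge0 ?expR_ge0 ?(ltW p1).
rewrite exprMn mulrCA ler_wpM2l ?exprn_ge0 ?invr_ge0 ?(ltW p1) //.
rewrite qE -!expRM_natl -expRD ler_expR.
have kan : (k + a)%:R <= n%:R * (1 + gamma).
  have : k%:R <= n%:R :> R by rewrite ler_nat nE leq_addr.
  by rewrite natrD mulrDr mulr1 (mulrC _ gamma) => kn; apply: lerD.
have h1 := ler_wpM2r (ltW lnq) kan.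
have h2 := ler_wpM2l (ler0n R n) leta.
lra.
Qed.

Local Open Scope classical_set_scope.
Local Open Scope ring_scope.

Theorem theorem3p3 (R : realType) (q : nat) (delta gamma rho : R)
  (hq : (2 <= q)%N)
  (hdelta : 0 <= delta <= 1 - q%:R^-1)
  (hgamma : 0 <= gamma <= (q%:R - 1) * (1 - delta))
  (hrho0 : 0 <= rho)
  (hrho : rho < 1 - (1 - delta + gamma) * entropy q (gamma / (1 - delta + gamma))
                  - entropy q delta + gamma * logq q (q%:R - 1)) :
  exists L : {poly R},
    prob_list_decodable q rho gamma delta (fun n : nat => L.[n%:R])
      @ \oo --> (1 : R).
Proof.
case/andP: hgamma => g0 _.
have [l [K leK]] := prob_list_decodable_exp hq hdelta g0 hrho.
exists (l%:R)%:P.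
rewrite (_ : (fun n : nat => _) = fun=> l%:R); last by apply/funext => n; rewrite hornerC.
(* The upper bound 1 holds because the value is a proportion. *)
apply: (@squeeze_cvgr _ _ _ _ (fun n => 1 - K * expR (-1) ^+ n) (fun=> 1)).
- apply: nearW => n; rewrite leK /= /prob_list_decodable /Defs.uniform_prob.
  by rewrite ler_pdivrMr ?mul1r ?ler_nat ?max_card // ltr0n card_ffun card_tuple !card_ord !expn_gt0 (ltnW hq).
- rewrite -[X in _ --> X]subr0 -[X in _ --> _ - X](mulr0 K).
  apply: cvgB; first exact: cvg_cst.
  apply: cvgMr; apply: cvg_expr.
  by rewrite ger0_norm ?expR_ge0 // -expR0 ltr_expR; lra.
- exact: cvg_cst.
Qed.
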